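(* Let $D_1,D_2,D_3$ be three smooth strictly convex outer billiard tables and $T_1,T_2,T_3$ the respective outer billiard maps. Then the set of fixed points of $T_3\circ T_2\circ T_1$ has empty interior.
   Context: An outer billiard table is a strictly convex compact plane domain $D$ (here with smooth boundary). The outer billiard map $T$ is defined on the exterior of $D$: for $x$ outside $D$, take the right support line from $x$ to $D$ (from $x$'s viewpoint) and reflect $x$ in the support point to obtain $T(x)$. *)

(* Defs.v *)
From Stdlib Require Import Reals.
From Coquelicot Require Import Coquelicot.
Open Scope R_scope.

Definition pt := (R * R)%type.

Definition padd (p q : pt) : pt := (fst p + fst q, snd p + snd q).
Definition psub (p q : pt) : pt := (fst p - fst q, snd p - snd q).
Definition pscal (t : R) (p : pt) : pt := (t * fst p, t * snd p).

Definition cross (u v : pt) : R := fst u * snd v - snd u * fst v.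

Definition pdist (p q : pt) : R :=
  sqrt ((fst p - fst q) ^ 2 + (snd p - snd q) ^ 2).
Definition in_ball (c : pt) (r : R) (x : pt) : Prop := pdist c x < r.

Definition pinterior (D : pt -> Prop) (x : pt) : Prop :=
  exists r, 0 < r /\ forall y, in_ball x r y -> D y.

Definition p_open (U : pt -> Prop) : Prop := forall x, U x -> pinterior U x.
Definition p_closed (D : pt -> Prop) : Prop := p_open (fun x => ~ D x).
Definition is_bounded (D : pt -> Prop) : Prop :=
  exists M, forall x, D x -> pdist (0, 0) x <= M.
Definition is_compact (D : pt -> Prop) : Prop := p_closed D /\ is_bounded D.

(* topological pboundary of a closed set *)
Definition pboundary (D : pt -> Prop) (x : pt) : Prop := D x /\ ~ pinterior D x.

Definition strictly_convex (D : pt -> Prop) : Prop :=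
  forall p q t, D p -> D q -> p <> q -> 0 < t < 1 ->
    pinterior D (padd p (pscal t (psub q p))).

Definition pconvex (D : pt -> Prop) : Prop :=
  forall p q t, D p -> D q -> 0 <= t <= 1 -> D (padd p (pscal t (psub q p))).

Definition smooth_fun (f : R -> R) : Prop := forall n t, ex_derive_n f n t.

Definition smooth_boundary (D : pt -> Prop) : Prop :=
  exists (g : R -> pt) (L : R),
    0 < L /\
    smooth_fun (fun t => fst (g t)) /\ smooth_fun (fun t => snd (g t)) /\
    (forall t, g (t + L) = g t) /\
    (forall s t, 0 <= s < L -> 0 <= t < L -> g s = g t -> s = t) /\
    (forall t, Derive (fun u => fst (g u)) t <> 0 \/
               Derive (fun u => snd (g u)) t <> 0) /\
    (forall x, pboundary D x <-> exists t, g t = x).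

Definition outer_billiard_table (D : pt -> Prop) : Prop :=
  is_compact D /\ pconvex D /\ strictly_convex D /\ (exists x, pinterior D x) /\
  smooth_boundary D.

(* Graph of the outer billiard map T of D: for x outside D, p is the support
   point of the right support line from x (D lies to the left of the oriented
   line from x through p), and T x = 2 p - x = p + (p - x).
   For a strictly convex domain p is unique, so this relation is the graph of
   the (partial) map T defined on the exterior of D. *)
Definition outer_billiard (D : pt -> Prop) (x y : pt) : Prop :=
  ~ D x /\
  exists p, D p /\ (forall q, D q -> 0 <= cross (psub p x) (psub q x)) /\
            y = padd p (psub p x).

(* Main.v *)
Require Import Defs.
From Stdlib Require Import Reals Lra Lia List Classical IndefiniteDescription.
From Coquelicot Require Import Coquelicot.
Import ListNotations.
Open Scope R_scope.

(** Suppose that every [z] in an open set is the vertex of a billiard triangle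
    [z], [y1], [y2], whose sides touch [D1], [D2], [D3] at their midpoints. Moving
    [z] along its support line to [D1] scales the side [z y1] about its midpoint
    [p] by a factor [m]. Comparing the support inequalities of [D2] and [D3] at
    two values of [m] shows that the area of the triangle is constant, and that
    the direction of [y2 - p] is constant, up to errors quadratic in the change
    of [m]; hence [m (y2 - p)] is constant. The midpoint of [y1 y2] then runs
    along a hyperbola centred at [p], and by continuity of the support point this
    arc contains the contact points with [D2] for all [z] nearby. Two hyperbolas
    sharing an arc have the same centre, so [p] is the same for all [z] nearby;
    but only the points of one line see [D1] touched at [p], since its boundary
    is smooth. *)

(** * Plane geometry *)

Definition midpoint (p q : pt) : pt := pscal (1 / 2) (padd p q).

Definition homothety (c : pt) (k : R) (x : pt) : pt := padd c (pscal k (psub x c)).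

Ltac unfold_pt := unfold midpoint, homothety, padd, psub, pscal, cross in *; cbn [fst snd] in *.

Lemma psub_eq0 (p q : pt) : psub p q = (0, 0) -> p = q.
Proof.
  intros E; injection E; intros; apply injective_projections; lra.
Qed.

Lemma cross_nondegenerate (u v c : pt) :
  cross u v <> 0 -> cross c u = 0 -> cross c v = 0 -> c = (0, 0).
Proof.
  intros Huv Hu Hv; apply injective_projections; apply Rmult_eq_reg_l with (cross u v); trivial.
  - transitivity (fst u * cross c v - fst v * cross c u); [unfold_pt; ring|].
    rewrite Hu, Hv; simpl; ring.
  - transitivity (snd u * cross c v - snd v * cross c u); [unfold_pt; ring|].
    rewrite Hu, Hv; simpl; ring.
Qed.

Lemma cross_parallel (g u v : pt) :
  g <> (0, 0) -> cross u g = 0 -> cross v g = 0 -> cross u v = 0.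
Proof.
  intros Hg Hu Hv; apply NNPP; intros Huv; apply Hg.
  apply (cross_nondegenerate u v); trivial; unfold_pt; lra.
Qed.

Lemma cross_collinear (u x y z : pt) (c : R) :
  c <> 0 -> cross x u = c -> cross y u = c -> cross z u = c ->
  cross y z = cross y x - cross z x.
Proof.
  intros Hc Hx Hy Hz; apply Rmult_eq_reg_l with c; trivial.
  transitivity (cross z u * cross y x - cross y u * cross z x).
  - rewrite <- Hx; unfold_pt; ring.
  - rewrite Hy, Hz; ring.
Qed.

Lemma homothety_1 (c x : pt) : homothety c 1 x = x.
Proof. apply injective_projections; unfold_pt; ring. Qed.

Lemma homothety_fixed (c x : pt) (k : R) : k <> 0 -> homothety c k x = c -> x = c.
Proof.
  intros Hk E; apply (f_equal (fun y => psub y c)) in E; injection E; intros Esnd Efst.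
  apply injective_projections; apply Rmult_eq_reg_l with k; unfold_pt; lra.
Qed.

Lemma homothety_inverse (c x y : pt) (k : R) :
  k <> 0 -> pscal k (psub y c) = psub x c -> y = homothety c (/ k) x.
Proof.
  intros Hk E; unfold homothety; rewrite <- E.
  apply injective_projections; unfold_pt; field; trivial.
Qed.

Lemma pdist_norm (p q : pt) : pdist p q = norm (minus q p).
Proof.
  change (norm (minus q p)) with
    (sqrt (Rabs (fst q - fst p) ^ 2 + Rabs (snd q - snd p) ^ 2)).
  rewrite !pow2_abs; unfold pdist; f_equal; ring.
Qed.

Lemma pinterior_locally (D : pt -> Prop) (x : pt) : pinterior D x <-> locally x D.
Proof.
  pose (V := prod_NormedModule R_AbsRing R_NormedModule R_NormedModule).
  split.
  - intros [r [Hr H]]; apply (locally_le_locally_norm (V := V)); exists (mkposreal r Hr).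
    intros y Hy; apply H; unfold in_ball; rewrite pdist_norm; exact Hy.
  - intros H; apply (locally_norm_le_locally (V := V)) in H as [r H].
    exists r; split; [apply cond_pos|].
    intros y Hy; apply H; unfold in_ball in Hy; rewrite pdist_norm in Hy; exact Hy.
Qed.

Lemma locally_preimage {T U : UniformSpace} (f : T -> U) (x : T) (P : U -> Prop) :
  continuous f x -> locally (f x) P -> locally x (fun y => P (f y)).
Proof. intros Cf; apply Cf. Qed.

Section PlaneContinuity.

Context {T : UniformSpace}.

Lemma continuous_psub (f g : T -> pt) (x : T) :
  continuous f x -> continuous g x -> continuous (fun y => psub (f y) (g y)) x.
Proof. exact (continuous_minus f g x). Qed.

Lemma continuous_padd (f g : T -> pt) (x : T) :
  continuous f x -> continuous g x -> continuous (fun y => padd (f y) (g y)) x.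
Proof. exact (continuous_plus f g x). Qed.

Lemma continuous_pscal (k : T -> R) (f : T -> pt) (x : T) :
  continuous k x -> continuous f x -> continuous (fun y => pscal (k y) (f y)) x.
Proof. exact (continuous_scal k f x). Qed.

Lemma continuous_cross (f g : T -> pt) (x : T) :
  continuous f x -> continuous g x -> continuous (fun y => cross (f y) (g y)) x.
Proof.
  intros Hf Hg.
  assert (Hfst : forall h : T -> pt, continuous h x -> continuous (fun y => fst (h y)) x).
  { intros h Hh; apply (continuous_comp h fst); trivial.
    destruct (h x); apply continuous_fst. }
  assert (Hsnd : forall h : T -> pt, continuous h x -> continuous (fun y => snd (h y)) x).
  { intros h Hh; apply (continuous_comp h snd); trivial.
    destruct (h x); apply continuous_snd. }
  apply (continuous_minus (fun y => fst (f y) * snd (g y)) (fun y => snd (f y) * fst (g y)));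
    apply @continuous_mult; auto.
Qed.

Lemma continuous_Rdiv (f g : T -> R) (x : T) :
  continuous f x -> continuous g x -> g x <> 0 -> continuous (fun y => f y / g y) x.
Proof.
  intros Hf Hg Hne; apply @continuous_mult; trivial.
  apply (continuous_comp g Rinv); trivial; now apply continuous_Rinv.
Qed.

End PlaneContinuity.

Lemma locally_homothety (c x : pt) (P : pt -> Prop) :
  locally x P -> locally 1 (fun m => P (homothety c m x)).
Proof.
  intros HP; rewrite <- (homothety_1 c x) in HP.
  apply (locally_preimage (fun m => homothety c m x)); trivial.
  apply continuous_padd; [apply continuous_const|].
  apply continuous_pscal; [apply continuous_id|apply continuous_const].
Qed.

Lemma bounded_tube {T : UniformSpace} (K : pt -> Prop) (x0 : T) (P : T * pt -> Prop) :
  is_bounded K -> (forall q, locally (x0, q) P) ->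
  locally x0 (fun x => forall q, K q -> P (x, q)).
Proof.
  intros [M HM] HP; apply functional_choice in HP as [delta Hdelta].
  destruct (compactness_value_2d (- M) M (- M) M (fun a b => delta (a, b))) as [d Hd].
  exists d; intros x Hx q Kq; apply NNPP; intros Hn.
  assert (Hq : Rabs (fst q) <= M /\ Rabs (snd q) <= M).
  { assert (Hnorm : norm q <= M).
    { rewrite <- (minus_zero_r q), <- (pdist_norm (0, 0)); now apply HM. }
    destruct q as [a b]; pose proof (proj1 (norm_prod a b)) as Hmax.
    change (Rmax (Rabs a) (Rabs b) <= norm (a, b)) in Hmax.
    pose proof (Rmax_l (Rabs a) (Rabs b)); pose proof (Rmax_r (Rabs a) (Rabs b)).
    simpl; lra. }
  destruct Hq as [Ha Hb]; apply Rabs_le_between in Ha, Hb.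
  apply (Hd (fst q) (snd q)); trivial.
  intros [a [b [_ [_ [Hqa [Hqb Hle]]]]]].
  apply Hn, (Hdelta (a, b)); repeat split; trivial.
  now apply ball_le with d.
Qed.

Lemma locally_right_of_line (D : pt -> Prop) (u x : pt) :
  u <> (0, 0) -> locally x D -> exists y, D y /\ cross u (psub y x) < 0.
Proof.
  intros Hu HD; set (y := fun s : R => padd x (pscal s (snd u, - fst u))).
  assert (Cy : continuous y 0).
  { apply continuous_padd; [apply continuous_const|].
    apply continuous_pscal; [apply continuous_id|apply continuous_const]. }
  assert (Ey : x = y 0) by (apply injective_projections; unfold y; unfold_pt; ring).
  rewrite Ey in HD; apply locally_preimage in HD; trivial.
  destruct (filter_ex (F := at_right 0) (fun s => D (y s) /\ 0 < s)) as [s [Ds Hs]].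
  { unfold at_right, within; revert HD; apply filter_imp; tauto. }
  exists (y s); split; trivial; unfold y.
  assert (0 < fst u * fst u + snd u * snd u).
  { apply Rnot_le_lt; intros Hle; apply Hu; apply injective_projections; simpl; nra. }
  unfold_pt; nra.
Qed.

(** * Support points *)

Definition support_point (D : pt -> Prop) (x p : pt) : Prop :=
  ~ D x /\ D p /\ forall q, D q -> 0 <= cross (psub p x) (psub q x).

Lemma support_point_mem (D : pt -> Prop) (x p : pt) : support_point D x p -> D p.
Proof. now intros [_ [Dp _]]. Qed.

Lemma support_point_ge0 (D : pt -> Prop) (x p q : pt) :
  support_point D x p -> D q -> 0 <= cross (psub p x) (psub q x).
Proof. intros [_ [_ Hp]]; apply Hp. Qed.

Lemma outer_billiard_support_point (D : pt -> Prop) (x y : pt) :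
  outer_billiard D x y <-> support_point D x (midpoint x y).
Proof.
  split.
  - intros [Hx [p [Dp [Hp ->]]]].
    replace (midpoint _ _) with p by (apply injective_projections; unfold_pt; field).
    now repeat split.
  - intros [Hx [Dp Hp]]; split; trivial; exists (midpoint x y); repeat split; trivial.
    apply injective_projections; unfold_pt; field.
Qed.

Lemma support_point_neq (D : pt -> Prop) (x p : pt) : support_point D x p -> p <> x.
Proof. intros [Hx [Dp _]] E; now rewrite E in Dp. Qed.

Lemma support_point_dir_neq0 (D : pt -> Prop) (x p : pt) :
  support_point D x p -> psub p x <> (0, 0).
Proof. intros Hp E; now apply (support_point_neq _ _ _ Hp), psub_eq0. Qed.

Lemma support_point_strict (D : pt -> Prop) (x p q : pt) :
  strictly_convex D -> support_point D x p -> D q -> q <> p ->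
  0 < cross (psub p x) (psub q x).
Proof.
  intros D_strict Hp Dq Hqp.
  assert (Hi := D_strict p q (1 / 2) (support_point_mem _ _ _ Hp) Dq (not_eq_sym Hqp) ltac:(lra)).
  apply pinterior_locally in Hi.
  destruct (locally_right_of_line _ _ _ (support_point_dir_neq0 _ _ _ Hp) Hi) as [y [Dy Hy]].
  assert (Hge0 := support_point_ge0 _ _ _ _ Hp Dy); unfold_pt; lra.
Qed.

Lemma support_point_unique (D : pt -> Prop) (x p q : pt) :
  strictly_convex D -> support_point D x p -> support_point D x q -> p = q.
Proof.
  intros D_strict Hp Hq; apply NNPP; intros Hpq.
  assert (Dp := support_point_mem _ _ _ Hp); assert (Dq := support_point_mem _ _ _ Hq).
  assert (q_left_of_p := support_point_strict _ _ _ _ D_strict Hp Dq (not_eq_sym Hpq)).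
  assert (p_left_of_q := support_point_strict _ _ _ _ D_strict Hq Dp Hpq).
  unfold cross in *; lra.
Qed.

Lemma outer_billiard_unique (D : pt -> Prop) (x y y' : pt) :
  strictly_convex D -> outer_billiard D x y -> outer_billiard D x y' -> y = y'.
Proof.
  intros D_strict Hy Hy'; apply outer_billiard_support_point in Hy, Hy'.
  assert (E := support_point_unique _ _ _ _ D_strict Hy Hy').
  injection E; intros; apply injective_projections; lra.
Qed.

Lemma support_point_homothety (D : pt -> Prop) (x p : pt) (k : R) :
  strictly_convex D -> 0 < k -> support_point D x p -> support_point D (homothety p k x) p.
Proof.
  intros D_strict Hk Hp; repeat split.
  - intros Dx.
    assert (Hne : homothety p k x <> p).
    { intros E; apply homothety_fixed in E; [|lra].
      now apply (support_point_neq _ _ _ Hp). }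
    assert (Hgt0 := support_point_strict _ _ _ _ D_strict Hp Dx Hne).
    unfold_pt; lra.
  - apply Hp.
  - intros q Dq; assert (Hge0 := support_point_ge0 _ _ _ _ Hp Dq).
    apply (Rmult_le_compat_l k) in Hge0; [|lra]; unfold_pt; lra.
Qed.

Lemma outer_billiard_homothety (D : pt -> Prop) (x y : pt) (m : R) :
  strictly_convex D -> 0 < m -> outer_billiard D x y ->
  outer_billiard D (homothety (midpoint x y) m x) (homothety (midpoint x y) m y).
Proof.
  intros D_strict Hm Hy; apply outer_billiard_support_point in Hy.
  apply outer_billiard_support_point.
  replace (midpoint (homothety _ _ _) _) with (midpoint x y)
    by (apply injective_projections; unfold_pt; field).
  now apply support_point_homothety.
Qed.

(* A point q other than p0 has a neighbourhood that contains no support point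
   of any x close to x0; compactness makes the distance to x0 uniform in q. *)
Lemma support_point_continuous (D : pt -> Prop) (x0 p0 : pt) (P : pt * pt -> Prop) :
  is_compact D -> strictly_convex D -> support_point D x0 p0 -> locally (x0, p0) P ->
  locally x0 (fun x => forall p, support_point D x p -> P (x, p)).
Proof.
  intros [D_closed D_bounded] D_strict Hp0 HP.
  apply filter_imp with (fun x => forall q, D q -> support_point D x q -> P (x, q)).
  { intros x Hx p Hp; apply Hx; trivial; apply Hp. }
  apply (bounded_tube D x0 (fun z => support_point D (fst z) (snd z) -> P z)); trivial.
  intros q.
  destruct (classic (D q)) as [Dq|Dq].
  2: { apply D_closed, pinterior_locally in Dq.
       generalize (locally_preimage snd (x0, q) _ (continuous_snd x0 q) Dq); apply filter_imp.
       intros z Hz Hs; exfalso; apply Hz, Hs. }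
  destruct (classic (forall s, D s -> 0 <= cross (psub q x0) (psub s x0))) as [Hq|Hq].
  - assert (E : p0 = q).
    { apply (support_point_unique D x0); trivial; repeat split; trivial; apply Hp0. }
    rewrite <- E; revert HP; apply filter_imp; auto.
  - apply not_all_ex_not in Hq as [s Hs]; apply imply_to_and in Hs as [Ds Hs].
    apply Rnot_le_lt, open_lt in Hs.
    set (f := fun z : pt * pt => cross (psub (snd z) (fst z)) (psub s (fst z))).
    assert (Cf : continuous f (x0, q)).
    { apply continuous_cross; apply continuous_psub; try apply continuous_const;
        first [apply continuous_fst | apply continuous_snd]. }
    generalize (locally_preimage f _ _ Cf Hs); apply filter_imp.
    intros z Hz [_ [_ Hsup]]; exfalso; exact (Rlt_not_le _ _ Hz (Hsup s Ds)).
Qed.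

Lemma outer_billiard_continuous (D : pt -> Prop) (x0 y0 : pt) (P : pt -> Prop) :
  is_compact D -> strictly_convex D -> outer_billiard D x0 y0 -> locally y0 P ->
  locally x0 (fun x => forall y, outer_billiard D x y -> P y).
Proof.
  intros D_compact D_strict Hy0 HP.
  set (f := fun z : pt * pt => padd (snd z) (psub (snd z) (fst z))).
  assert (Ef : forall x y, f (x, midpoint x y) = y)
    by (intros; apply injective_projections; unfold f; unfold_pt; field).
  assert (Cf : continuous f (x0, midpoint x0 y0)).
  { apply continuous_padd; [apply continuous_snd|].
    apply continuous_psub; [apply continuous_snd|apply continuous_fst]. }
  rewrite <- (Ef x0 y0) in HP; apply outer_billiard_support_point in Hy0.
  generalize (support_point_continuous _ _ _ _ D_compact D_strict Hy0
    (locally_preimage f _ _ Cf HP)).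
  apply filter_imp; intros x Hx y Hy; apply outer_billiard_support_point in Hy.
  rewrite <- (Ef x y); exact (Hx _ Hy).
Qed.

Lemma homothety_lines_meet (c x0 p0 : pt) (Q : R -> Prop) :
  cross (psub x0 c) (psub p0 c) <> 0 -> locally 1 Q ->
  locally (x0, p0) (fun z =>
    exists k m, 0 < k /\ Q m /\ homothety (snd z) k (fst z) = homothety c m x0).
Proof.
  intros Hc HQ.
  set (den := fun z : pt * pt => cross (psub x0 c) (psub (fst z) (snd z))).
  set (k := fun z : pt * pt => cross (psub (snd z) c) (psub x0 c) / den z).
  set (m := fun z : pt * pt => cross (psub (snd z) c) (psub (fst z) (snd z)) / den z).
  assert (Hden : den (x0, p0) <> 0) by (unfold den in *; unfold_pt; lra).
  assert (Ek : k (x0, p0) = 1) by (unfold k, den in *; unfold_pt; field; lra).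
  assert (Em : m (x0, p0) = 1) by (unfold m, den in *; unfold_pt; field; lra).
  assert (Cfst := continuous_fst x0 p0); assert (Csnd := continuous_snd x0 p0).
  assert (Cden : continuous den (x0, p0)).
  { apply continuous_cross; [apply continuous_const|now apply continuous_psub]. }
  assert (Ck : continuous k (x0, p0)).
  { apply continuous_Rdiv; trivial.
    apply continuous_cross; [|apply continuous_const].
    apply continuous_psub; [exact Csnd|apply continuous_const]. }
  assert (Cm : continuous m (x0, p0)).
  { apply continuous_Rdiv; trivial; apply continuous_cross; apply continuous_psub;
      trivial; apply continuous_const. }
  assert (Lden := locally_preimage den _ _ Cden (open_neq 0 _ Hden)).
  assert (Lk : locally (k (x0, p0)) (fun t => 0 < t)) by (apply open_gt; lra).
  rewrite <- Em in HQ.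
  assert (Lm := locally_preimage m _ _ Cm HQ); apply (locally_preimage k _ _ Ck) in Lk.
  generalize (filter_and _ _ Lden (filter_and _ _ Lk Lm)); apply filter_imp.
  intros [x p] [Dz [Kz Mz]]; exists (k (x, p)), (m (x, p)); repeat split; trivial.
  apply injective_projections; unfold k, m, den in *; unfold_pt; field; lra.
Qed.

Lemma nearby_support_point_from_line (D : pt -> Prop) (c x0 p0 : pt) (Q : R -> Prop) :
  is_compact D -> strictly_convex D -> support_point D x0 p0 ->
  cross (psub x0 c) (psub p0 c) <> 0 -> locally 1 Q ->
  locally x0 (fun x => forall p, support_point D x p ->
    exists m, Q m /\ support_point D (homothety c m x0) p).
Proof.
  intros D_compact D_strict Hp0 Hc HQ.
  generalize (support_point_continuous _ _ _ _ D_compact D_strict Hp0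
    (homothety_lines_meet _ _ _ _ Hc HQ)).
  apply filter_imp; intros x Hx p Hp; destruct (Hx p Hp) as [k [m [Hk [Qm E]]]]; simpl in E.
  exists m; split; trivial; rewrite <- E; now apply support_point_homothety.
Qed.

Lemma Derive_global_min (f : R -> R) (t : R) :
  ex_derive f t -> (forall s, f t <= f s) -> Derive f t = 0.
Proof.
  intros Hd Hm; assert (pr : derivable_pt f t) by now apply ex_derive_Reals_0.
  rewrite <- (Derive_Reals f t pr).
  apply (deriv_minimum f (t - 1) (t + 1)); intros; auto; lra.
Qed.

Lemma support_directions_parallel (D : pt -> Prop) (p u v : pt) :
  smooth_boundary D -> D p -> u <> (0, 0) ->
  (forall q, D q -> 0 <= cross u (psub q p)) ->
  (forall q, D q -> 0 <= cross v (psub q p)) -> cross u v = 0.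
Proof.
  intros [g [L [_ [smooth_fst [smooth_snd [_ [_ [Hreg Hb]]]]]]]] Dp Hu Hsu Hsv.
  assert (Bp : pboundary D p).
  { split; trivial; intros Hi; apply pinterior_locally in Hi.
    destruct (locally_right_of_line D u p Hu Hi) as [y [Dy Hy]].
    specialize (Hsu y Dy); lra. }
  destruct (proj1 (Hb p) Bp) as [t0 Et].
  assert (Dg : forall t, D (g t)) by (intros t; apply (proj2 (Hb (g t))); now exists t).
  set (tangent := (Derive (fun t => fst (g t)) t0, Derive (fun t => snd (g t)) t0)).
  assert (Htan : forall w, (forall q, D q -> 0 <= cross w (psub q p)) -> cross w tangent = 0).
  { intros w Hw; set (f := fun t => fst w * snd (g t) - snd w * fst (g t)).
    assert (Hf : is_derive f t0 (cross w tangent)).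
    { apply @is_derive_minus; apply is_derive_scal, Derive_correct;
        [exact (smooth_snd 1%nat t0)|exact (smooth_fst 1%nat t0)]. }
    rewrite <- (is_derive_unique _ _ _ Hf); apply Derive_global_min; [eexists; exact Hf|].
    intros s; specialize (Hw _ (Dg s)); unfold f; rewrite Et; unfold_pt; lra. }
  apply (cross_parallel tangent); auto.
  intros E; injection E; intros; destruct (Hreg t0); auto.
Qed.

Lemma support_point_not_locally_constant (D : pt -> Prop) (x c : pt) :
  smooth_boundary D -> ~ locally x (fun y => support_point D y c).
Proof.
  intros D_smooth Hnear; assert (Hx := locally_singleton _ _ Hnear).
  assert (Hu := support_point_dir_neq0 _ _ _ Hx).
  destruct (locally_right_of_line _ _ _ Hu Hnear) as [y [Hy Hneg]].
  assert (Hside : forall z, support_point D z c ->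
    forall q, D q -> 0 <= cross (psub c z) (psub q c)).
  { intros z Hz q Dq; assert (Hge0 := support_point_ge0 _ _ _ _ Hz Dq); unfold_pt; lra. }
  assert (Hpar : cross (psub c x) (psub c y) = 0).
  { apply (support_directions_parallel D c); auto; apply Hx. }
  unfold_pt; lra.
Qed.

(** * One-variable analysis *)

Lemma is_derive_0_quadratic (f : R -> R) (x C : R) :
  locally x (fun y => Rabs (f y - f x) <= C * (y - x) ^ 2) -> is_derive f x 0.
Proof.
  intros [d Hd]; apply is_derive_Reals; intros eps Heps.
  pose proof (Rle_abs C); pose proof (Rabs_pos C).
  assert (He : 0 < eps / (Rabs C + 1)) by (apply Rdiv_lt_0_compat; lra).
  exists (mkposreal _ (Rmin_pos _ _ (cond_pos d) He)); intros h Hh Hhd; simpl in Hhd.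
  pose proof (Rmin_l d (eps / (Rabs C + 1))); pose proof (Rmin_r d (eps / (Rabs C + 1))).
  assert (Hq : Rabs (f (x + h) - f x) <= C * h ^ 2).
  { replace (h ^ 2) with ((x + h - x) ^ 2) by ring; apply Hd.
    change (Rabs (x + h - x) < d); replace (x + h - x) with h by ring; lra. }
  assert (Hheps : (Rabs C + 1) * Rabs h < eps).
  { apply Rlt_le_trans with ((Rabs C + 1) * (eps / (Rabs C + 1))).
    - apply Rmult_lt_compat_l; lra.
    - right; field; lra. }
  pose proof (Rabs_pos_lt h Hh).
  rewrite Rminus_0_r, Rabs_div by trivial.
  apply Rmult_lt_reg_r with (Rabs h); trivial.
  unfold Rdiv; rewrite Rmult_assoc, Rinv_l, Rmult_1_r by lra.
  rewrite <- pow2_abs in Hq; nra.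
Qed.

Lemma constant_of_quadratic (f : R -> R) (a b : R) :
  (forall x, a < x < b -> exists C, locally x (fun y => Rabs (f y - f x) <= C * (y - x) ^ 2)) ->
  forall x y, a < x < b -> a < y < b -> f x = f y.
Proof.
  intros Hquad.
  assert (Hlt : forall x y, a < x < b -> a < y < b -> x < y -> f x = f y).
  { intros x y Hx Hy Hxy; apply (eq_is_derive f); trivial.
    intros t Ht; destruct (Hquad t) as [C HC]; [lra|]; now apply is_derive_0_quadratic with C. }
  intros x y Hx Hy; destruct (Rtotal_order x y) as [Hxy|[->|Hxy]]; auto; now symmetry; auto.
Qed.

Lemma locally_between (a b x : R) : a < x < b -> locally x (fun y => a < y < b).
Proof. intros Hx; apply filter_and; [apply open_gt|apply open_lt]; apply Hx. Qed.

Lemma sum_n_split_first (f : nat -> R) (n : nat) :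
  sum_n f (S n) = f O + sum_n (fun k => f (S k)) n.
Proof. unfold sum_n; rewrite sum_Sn_m, sum_n_m_S by lia; reflexivity. Qed.

Lemma polynomial_locally_zero (a : nat -> R) (n : nat) (x0 : R) :
  locally x0 (fun x => sum_n (fun k => a k * x ^ k) n = 0) ->
  forall k, (k <= n)%nat -> a k = 0.
Proof.
  revert a; induction n as [|n IH]; intros a Hzero.
  - intros k Hk; apply locally_singleton in Hzero; rewrite sum_O in Hzero.
    replace k with O by lia; simpl in Hzero; lra.
  - assert (Hder : locally x0 (fun x => sum_n (fun k => a (S k) * INR (S k) * x ^ k) n = 0)).
    { apply locally_locally in Hzero; revert Hzero; apply filter_imp; intros x Hx.
      transitivity (Derive (fun y => sum_n (fun k => a k * y ^ k) (S n)) x).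
      - symmetry; apply is_derive_unique.
        replace (sum_n _ n) with (sum_n (fun k => a k * (INR k * x ^ pred k)) (S n)).
        + apply (is_derive_sum_n (fun k y => a k * y ^ k)); intros k _.
          auto_derive; trivial; ring.
        + rewrite sum_n_split_first; simpl (INR 0).
          rewrite Rmult_0_l, Rmult_0_r, Rplus_0_l; apply sum_n_ext; intros k.
          symmetry; apply Rmult_assoc.
      - rewrite (Derive_ext_loc _ (fun _ => 0)) by exact Hx; apply Derive_const. }
    assert (HS : forall k, (k <= n)%nat -> a (S k) = 0).
    { intros k Hk; apply Rmult_eq_reg_r with (INR (S k)); [|now apply not_0_INR].
      rewrite Rmult_0_l; now apply (IH _ Hder). }
    intros [|k] Hk; [|apply HS; lia].
    apply locally_singleton in Hzero; rewrite sum_n_split_first in Hzero.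
    rewrite (sum_n_ext_loc _ (fun _ => 0)), sum_n_const in Hzero.
    + simpl in Hzero; lra.
    + intros k Hkn; rewrite HS by trivial; apply Rmult_0_l.
Qed.

Lemma laurent_product_constant (a0 a1 a2 b0 b1 b2 K m0 : R) :
  m0 <> 0 -> a1 * b2 - a2 * b1 <> 0 ->
  locally m0 (fun m => (a0 + a1 * m + a2 / m) * (b0 + b1 * m + b2 / m) = K) ->
  a0 = 0 /\ b0 = 0.
Proof.
  intros Hm0 Hdet Hprod.
  set (coeffs := [a2 * b2; a0 * b2 + a2 * b0; a0 * b0 + a1 * b2 + a2 * b1 - K;
                  a0 * b1 + a1 * b0; a1 * b1]).
  assert (Hcoeffs : forall k, (k <= 4)%nat -> nth k coeffs 0 = 0).
  { apply (polynomial_locally_zero _ _ m0).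
    generalize (filter_and _ _ (open_neq 0 m0 Hm0) Hprod); apply filter_imp; intros m [Hm Hs].
    rewrite !sum_Sn, sum_O; unfold coeffs, plus; simpl.
    rewrite <- Hs; field; trivial. }
  assert (Hm1 := Hcoeffs 1%nat ltac:(lia)); assert (Hm3 := Hcoeffs 3%nat ltac:(lia)).
  assert (Hm4 := Hcoeffs 4%nat ltac:(lia)); simpl in Hm1, Hm3, Hm4.
  destruct (Rmult_integral _ _ Hm4) as [Ha1|Hb1].
  - assert (a2 <> 0 /\ b1 <> 0) as [Ha2 Hb1]
      by (split; intros E; apply Hdet; rewrite Ha1, E; ring).
    assert (Ea0 : a0 = 0) by (apply Rmult_eq_reg_r with b1; rewrite ?Ha1 in Hm3; lra).
    split; trivial; apply Rmult_eq_reg_l with a2; rewrite ?Ea0 in Hm1; lra.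
  - assert (a1 <> 0 /\ b2 <> 0) as [Ha1 Hb2]
      by (split; intros E; apply Hdet; rewrite Hb1, E; ring).
    assert (Eb0 : b0 = 0) by (apply Rmult_eq_reg_l with a1; rewrite ?Hb1 in Hm3; lra).
    split; trivial; apply Rmult_eq_reg_r with b2; rewrite ?Eb0 in Hm1; lra.
Qed.

(** * Hyperbolas *)

(* The asymptotes are the lines through c parallel to w and v. *)
Definition on_hyperbola (c w v : pt) (K : R) (s : pt) : Prop :=
  cross (psub s c) w * cross (psub s c) v = K.

Lemma midpoint_on_hyperbola (c x y : pt) (m : R) :
  m <> 0 ->
  on_hyperbola c (psub x c) (psub y c) (- cross (psub x c) (psub y c) ^ 2 / 4)
    (midpoint (homothety c m x) (homothety c (/ m) y)).
Proof. intros Hm; unfold on_hyperbola; unfold_pt; field; trivial. Qed.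

Lemma hyperbola_center_unique (c w v c' x y : pt) (K m0 : R) :
  m0 <> 0 -> cross w v <> 0 -> cross (psub x c') (psub y c') <> 0 ->
  locally m0 (fun m =>
    on_hyperbola c w v K (midpoint (homothety c' m x) (homothety c' (/ m) y))) ->
  c' = c.
Proof.
  intros Hm0 Hwv Hxy Hhyp.
  set (X := psub x c') in *; set (Y := psub y c') in *.
  destruct (laurent_product_constant
              (cross (psub c' c) w) (cross X w / 2) (cross Y w / 2)
              (cross (psub c' c) v) (cross X v / 2) (cross Y v / 2) K m0) as [Hw Hv];
    trivial.
  - replace (_ - _) with (cross w v * cross X Y / 4) by (unfold cross; field).
    assert (cross w v * cross X Y <> 0)
      by now apply Rmult_integral_contrapositive_currified.
    lra.
  - generalize (filter_and _ _ (open_neq 0 m0 Hm0) Hhyp); apply filter_imp; intros m [Hm <-].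
    unfold X, Y; unfold_pt; field; trivial.
  - now apply psub_eq0, (cross_nondegenerate w v).
Qed.

(** * Families with quadratically small cross products *)

(* The support inequalities of D2 and D3, applied to Z m = m (y2 - p) and
   multiplied by 4 m n, take the form 0 <= pinch + cross and 0 <= pinch - cross. *)
Definition pinch (u : pt) (m n : R) (Zm Zn : pt) : R :=
  m ^ 2 * (cross Zn u - cross Zm u) + (n - m) ^ 2 * cross Zm u.

Section PinchedFamily.

Variables (u : pt) (Z : R -> pt) (a b : R).
Hypothesis positive : forall m, a < m < b -> 0 < m.
Hypothesis pinched : forall m n, a < m < b -> a < n < b ->
  Rabs (cross (Z m) (Z n)) <= pinch u m n (Z m) (Z n).

Lemma pinched_cross_constant (m n : R) :
  a < m < b -> a < n < b -> cross (Z m) u = cross (Z n) u.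
Proof.
  revert m n; apply (constant_of_quadratic (fun m => cross (Z m) u)).
  intros m Hm; set (G := cross (Z m) u); exists (2 * Rabs G / m ^ 2).
  assert (Hm0 := positive m Hm); assert (Hm2 : 0 < m ^ 2) by now apply pow_lt.
  assert (Hloc : locally m (fun n => 3 / 4 * m < n /\ a < n /\ n < b)).
  { repeat apply filter_and; [apply open_gt|apply open_gt|apply open_lt]; lra. }
  revert Hloc; apply filter_imp; intros n [Hmn [Han Hnb]].
  assert (Hn : a < n < b) by lra.
  pose proof (Rle_trans _ _ _ (Rabs_pos _) (pinched m n Hm Hn)) as Lower.
  pose proof (Rle_trans _ _ _ (Rabs_pos _) (pinched n m Hn Hm)) as Upper.
  unfold pinch in Lower, Upper; fold G in Lower, Upper.
  (* [Upper] bounds [m (2 n - m) dG], where [3 / 4 * m < n] keeps the factor positive. *)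
  set (dG := cross (Z n) u - G) in *; set (e := (n - m) ^ 2) in *.
  assert (He : 0 <= e) by apply pow2_ge_0.
  pose proof (Rle_abs G); pose proof (Rle_abs (- G)) as HG; rewrite Rabs_Ropp in HG.
  assert (Lower_scaled : - (Rabs G * e) <= m ^ 2 * dG) by nra.
  assert (Upper_scaled : m * (2 * n - m) * dG <= Rabs G * e).
  { replace (m * (2 * n - m)) with (n ^ 2 - e) by (unfold e; ring); unfold e, dG in *; nra. }
  apply Rabs_le; split; apply Rmult_le_reg_l with (m ^ 2); trivial.
  - replace (m ^ 2 * _) with (- (2 * Rabs G * e)) by (field; lra).
    pose proof (Rabs_pos G); nra.
  - replace (m ^ 2 * (_ * e)) with (2 * Rabs G * e) by (field; lra).
    pose proof (Rabs_pos G).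
    assert (m ^ 2 <= 2 * (m * (2 * n - m))) by nra.
    destruct (Rle_dec 0 dG); nra.
Qed.

Lemma pinched_constant (m n : R) :
  a < m < b -> a < n < b -> cross (Z m) u <> 0 -> Z n = Z m.
Proof.
  intros Hm Hn Hc; set (c := cross (Z m) u) in *.
  assert (EG : forall k, a < k < b -> cross (Z k) u = c)
    by (intros k Hk; now apply pinched_cross_constant).
  assert (Hquad : forall k l, a < k < b -> a < l < b ->
    Rabs (cross (Z k) (Z l)) <= c * (l - k) ^ 2).
  { intros k l Hk Hl; eapply Rle_trans; [now apply pinched|].
    unfold pinch; rewrite !EG by trivial; right; ring. }
  assert (Ecross : cross (Z n) (Z m) = cross (Z m) (Z m)).
  { apply (constant_of_quadratic (fun k => cross (Z k) (Z m)) a b); trivial.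
    intros k Hk; exists c.
    generalize (locally_between _ _ _ Hk); apply filter_imp; intros l Hl.
    rewrite Rabs_minus_sym, <- (cross_collinear u (Z m) (Z k) (Z l) c) by auto.
    now apply Hquad. }
  apply psub_eq0, (cross_nondegenerate (Z m) u); trivial.
  - unfold_pt; lra.
  - specialize (EG n Hn); unfold c in *; unfold_pt; lra.
Qed.

End PinchedFamily.

(** * Billiard triangles *)

Definition billiard_triangle (D1 D2 D3 : pt -> Prop) (z y1 y2 : pt) : Prop :=
  outer_billiard D1 z y1 /\ outer_billiard D2 y1 y2 /\ outer_billiard D3 y2 z.

Definition billiard_vertex (D1 D2 D3 : pt -> Prop) (z : pt) : Prop :=
  exists y1 y2, billiard_triangle D1 D2 D3 z y1 y2.

Section BilliardTriangles.

Variables D1 D2 D3 : pt -> Prop.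
Hypothesis D1_strict : strictly_convex D1.
Hypothesis D2_strict : strictly_convex D2.
Hypothesis D3_strict : strictly_convex D3.

Section SlidingTriangle.

Variables z y1 : pt.
Let p := midpoint z y1.
Let u := psub y1 p.
Let slid_triangle (m : R) (y : pt) : Prop :=
  billiard_triangle D1 D2 D3 (homothety p m z) (homothety p m y1) y.

Lemma pinch_plus_cross (m n : R) (y y' : pt) :
  let Z := pscal m (psub y p) in
  let Z' := pscal n (psub y' p) in
  pinch u m n Z Z' + cross Z Z' =
  4 * m * n * cross (psub (midpoint (homothety p m y1) y) (homothety p m y1))
                    (psub (midpoint (homothety p n y1) y') (homothety p m y1)).
Proof. unfold pinch, u, p; unfold_pt; field. Qed.

Lemma pinch_minus_cross (m n : R) (y y' : pt) :
  let Z := pscal m (psub y p) in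
  let Z' := pscal n (psub y' p) in
  pinch u m n Z Z' - cross Z Z' =
  4 * m * n * cross (psub (midpoint y (homothety p m z)) y)
                    (psub (midpoint y' (homothety p n z)) y).
Proof. unfold pinch, u, p; unfold_pt; field. Qed.

Lemma slid_contacts_distinct (m n : R) (y y' : pt) :
  y1 <> z -> m <> n ->
  midpoint (homothety p m y1) y <> midpoint (homothety p n y1) y' \/
  midpoint y (homothety p m z) <> midpoint y' (homothety p n z).
Proof.
  intros Hy1 Hmn; apply not_and_or; intros [contact2 contact3]; apply Hy1.
  injection contact2; injection contact3; unfold p; unfold_pt; intros.
  apply injective_projections; apply Rmult_eq_reg_l with (m - n);
    first [lra | now apply Rminus_eq_contra].
Qed.

Lemma slid_apexes_pinched (m n : R) (y y' : pt) :
  0 < m -> 0 < n -> slid_triangle m y -> slid_triangle n y' ->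
  let Z := pscal m (psub y p) in
  let Z' := pscal n (psub y' p) in
  Rabs (cross Z Z') <= pinch u m n Z Z' /\ (m <> n -> 0 < pinch u m n Z Z').
Proof.
  intros Hm Hn [T1 [T2 T3]] [_ [T2' T3']] Z Z'.
  apply outer_billiard_support_point in T1, T2, T3, T2', T3'.
  assert (Eplus := pinch_plus_cross m n y y'); assert (Eminus := pinch_minus_cross m n y y').
  fold Z Z' in Eplus, Eminus; cbv zeta in Eplus, Eminus.
  assert (Hmn : 0 < 4 * m * n) by (repeat apply Rmult_lt_0_compat; lra).
  assert (mem2 := support_point_mem _ _ _ T2'); assert (mem3 := support_point_mem _ _ _ T3').
  assert (plus_ge0 := support_point_ge0 _ _ _ _ T2 mem2).
  assert (minus_ge0 := support_point_ge0 _ _ _ _ T3 mem3).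
  apply (Rmult_le_compat_l (4 * m * n)) in plus_ge0, minus_ge0; try lra.
  split; [apply Rabs_le; lra|]; intros Hne.
  assert (Hy1 : y1 <> z).
  { intros E; apply (support_point_neq _ _ _ T1); rewrite E.
    apply injective_projections; unfold_pt; field. }
  destruct (slid_contacts_distinct n m y' y Hy1 (not_eq_sym Hne)) as [contact2|contact3].
  - assert (plus_gt0 := support_point_strict _ _ _ _ D2_strict T2 mem2 contact2).
    apply (Rmult_lt_compat_l (4 * m * n)) in plus_gt0; lra.
  - assert (minus_gt0 := support_point_strict _ _ _ _ D3_strict T3 mem3 contact3).
    apply (Rmult_lt_compat_l (4 * m * n)) in minus_gt0; lra.
Qed.

Lemma slid_family :
  locally z (billiard_vertex D1 D2 D3) ->
  outer_billiard D1 z y1 ->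
  exists d Y, 0 < d /\ forall m, 1 - d < m < 1 + d -> 0 < m /\ slid_triangle m (Y m).
Proof.
  intros Hvertex T1.
  assert (Hslid : locally 1 (fun m => 0 < m /\ exists y, slid_triangle m y)).
  { assert (Hpos_near : locally 1 (fun m => 0 < m)) by (apply open_gt; lra).
    generalize (filter_and _ _ Hpos_near (locally_homothety p z _ Hvertex)); apply filter_imp.
    intros m [Hm [y1' [y2' T']]]; split; trivial; exists y2'.
    replace y1' with (homothety p m y1) in T'; trivial.
    apply (outer_billiard_unique D1 (homothety p m z)); trivial; [|apply T'].
    now apply outer_billiard_homothety. }
  destruct Hslid as [d Hd].
  assert (Hchoice : forall m, exists y, 1 - d < m < 1 + d -> 0 < m /\ slid_triangle m y).
  { intros m; destruct (classic (1 - d < m < 1 + d)) as [Hm|Hm]; [|now exists z].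
    destruct (Hd m) as [Hm0 [y Hy]].
    - change (Rabs (m - 1) < d); apply Rabs_def1; lra.
    - now exists y. }
  apply functional_choice in Hchoice as [Y HY].
  exists (pos d), Y; split; [apply cond_pos|trivial].
Qed.

Lemma slid_apexes_on_ray (d : R) (Y : R -> pt) :
  0 < d -> (forall m, 1 - d < m < 1 + d -> 0 < m /\ slid_triangle m (Y m)) ->
  cross u (psub (Y 1) p) <> 0 /\
  forall m, 1 - d < m < 1 + d -> Y m = homothety p (/ m) (Y 1).
Proof.
  intros Hd HY; set (Z := fun m => pscal m (psub (Y m) p)).
  assert (EZ1 : Z 1 = psub (Y 1) p) by (apply injective_projections; unfold Z; unfold_pt; ring).
  assert (Hpos := fun m Hm => proj1 (HY m Hm)).
  assert (Hpinch : forall m n, 1 - d < m < 1 + d -> 1 - d < n < 1 + d ->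
    Rabs (cross (Z m) (Z n)) <= pinch u m n (Z m) (Z n) /\
    (m <> n -> 0 < pinch u m n (Z m) (Z n))).
  { intros m n Hm Hn; apply slid_apexes_pinched; auto; now apply HY. }
  assert (Hweak := fun m n Hm Hn => proj1 (Hpinch m n Hm Hn)).
  assert (Hone : 1 - d < 1 < 1 + d) by lra.
  (* If it vanished, pinch would be 0, against strict convexity. *)
  assert (Hc : cross (Z 1) u <> 0).
  { intros E; set (k := 1 + d / 2); assert (Hk : 1 - d < k < 1 + d) by (unfold k; lra).
    destruct (Hpinch 1 k Hone Hk) as [_ Hstrict]; unfold pinch in Hstrict.
    rewrite <- (pinched_cross_constant u Z _ _ Hpos Hweak 1 k Hone Hk), E in Hstrict.
    assert (1 <> k) by (unfold k; lra); lra. }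
  split.
  - rewrite <- EZ1; unfold cross in *; lra.
  - intros m Hm; apply homothety_inverse; [now apply Rgt_not_eq, Hpos|].
    rewrite <- EZ1; now apply (pinched_constant u Z _ _ Hpos Hweak).
Qed.

Lemma billiard_triangle_slide (y2 : pt) :
  locally z (billiard_vertex D1 D2 D3) ->
  billiard_triangle D1 D2 D3 z y1 y2 ->
  cross (psub y1 p) (psub y2 p) <> 0 /\
  locally 1 (fun m =>
    billiard_triangle D1 D2 D3 (homothety p m z) (homothety p m y1) (homothety p (/ m) y2)).
Proof.
  intros Hvertex [T1 [T2 T3]]; destruct (slid_family Hvertex T1) as [d [Y [Hd HY]]].
  destruct (slid_apexes_on_ray d Y Hd HY) as [Hc EY].
  assert (Hone : 1 - d < 1 < 1 + d) by lra.
  assert (EY1 : Y 1 = y2).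
  { apply (outer_billiard_unique D2 y1); trivial.
    rewrite <- (homothety_1 p y1); apply (HY 1 Hone). }
  rewrite EY1 in Hc, EY; split; trivial.
  generalize (locally_between _ _ _ Hone); apply filter_imp; intros m Hm.
  rewrite <- EY by trivial; now apply HY.
Qed.

End SlidingTriangle.

Hypothesis D1_compact : is_compact D1.
Hypothesis D2_compact : is_compact D2.

Lemma nearby_contact_on_hyperbola (z y1 y2 : pt) :
  locally z (billiard_vertex D1 D2 D3) -> billiard_triangle D1 D2 D3 z y1 y2 ->
  exists c w v K, cross w v <> 0 /\
    locally z (fun z' => forall y1' y2', billiard_triangle D1 D2 D3 z' y1' y2' ->
      on_hyperbola c w v K (midpoint y1' y2')).
Proof.
  intros Hvertex T; destruct (billiard_triangle_slide z y1 y2 Hvertex T) as [Hc Hslide].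
  set (p := midpoint z y1) in *.
  exists p, (psub y1 p), (psub y2 p), (- cross (psub y1 p) (psub y2 p) ^ 2 / 4).
  split; trivial; destruct T as [T1 [T2 T3]].
  assert (Hsup2 := proj1 (outer_billiard_support_point _ _ _) T2).
  assert (Hc2 : cross (psub y1 p) (psub (midpoint y1 y2) p) <> 0) by (unfold_pt; lra).
  assert (Hpos_near : locally 1 (fun m => 0 < m)) by (apply open_gt; lra).
  generalize (outer_billiard_continuous _ _ _ _ D1_compact D1_strict T1
    (nearby_support_point_from_line _ _ _ _ _ D2_compact D2_strict Hsup2 Hc2
      (filter_and _ _ Hpos_near Hslide))).
  apply filter_imp; intros z' Hz' y1' y2' [T1' [T2' _]].
  apply outer_billiard_support_point in T2'.
  destruct (Hz' y1' T1' _ T2') as [m [[Hm [_ [Tm _]]] Hsup]].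
  apply outer_billiard_support_point in Tm.
  rewrite (support_point_unique _ _ _ _ D2_strict Hsup Tm).
  now apply midpoint_on_hyperbola, Rgt_not_eq.
Qed.

Lemma first_contact_locally_constant (z : pt) :
  locally z (billiard_vertex D1 D2 D3) ->
  exists c, locally z (fun z' => support_point D1 z' c).
Proof.
  intros Hvertex; destruct (locally_singleton _ _ Hvertex) as [y1 [y2 T]].
  destruct (nearby_contact_on_hyperbola z y1 y2 Hvertex T) as [c [w [v [K [Hwv Hhyp]]]]].
  exists c; apply locally_locally in Hvertex, Hhyp.
  generalize (filter_and _ _ Hvertex Hhyp); apply filter_imp; intros z' [Hvertex' Hhyp'].
  destruct (locally_singleton _ _ Hvertex') as [y1' [y2' T']].
  destruct (billiard_triangle_slide z' y1' y2' Hvertex' T') as [Hc Hslide].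
  set (p := midpoint z' y1') in *.
  assert (Ep : p = c).
  { apply (hyperbola_center_unique c w v p y1' y2' K 1); trivial.
    generalize (filter_and _ _ Hslide (locally_homothety p z' _ Hhyp')); apply filter_imp.
    intros m [Tm Hm]; exact (Hm _ _ Tm). }
  rewrite <- Ep; apply outer_billiard_support_point, T'.
Qed.

End BilliardTriangles.

Theorem theorem5p3 (D1 D2 D3 : pt -> Prop) :
  outer_billiard_table D1 -> outer_billiard_table D2 -> outer_billiard_table D3 ->
  ~ (exists x : pt, pinterior
       (fun z : pt => exists y1 y2 : pt,
           outer_billiard D1 z y1 /\ outer_billiard D2 y1 y2 /\
           outer_billiard D3 y2 z) x).
Proof.
  intros [D1_compact [_ [D1_strict [_ D1_smooth]]]] [D2_compact [_ [D2_strict _]]].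
  intros [_ [_ [D3_strict _]]] [z Hz]; apply pinterior_locally in Hz.
  destruct (first_contact_locally_constant D1 D2 D3) with (z := z) as [c Hc]; trivial.
  now apply (support_point_not_locally_constant D1 z c).
Qed.
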